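(* Let $\lambda\in\mathfrak t_n^*\simeq\mathbb R^n$. If $\lambda$ is generic (i.e. $\langle\lambda,\alpha^\vee\rangle=\lambda_j-\lambda_k\notin\mathbb Z$ for all roots, that is, for all $j\ne k$), then for $i\in\{1,\dots,n-1\}$ $$\mathscr T^{R}_{i,\lambda}\circ\mathscr T^{R}_{i,s_i\lambda}=-y\,\mathrm{id}.$$ For arbitrary $\lambda$ and $i\in\{1,\dots,n-2\}$, $$\mathscr T^{R}_{i,s_{i+1}s_i\lambda}\circ\mathscr T^{R}_{i+1,s_i\lambda}\circ\mathscr T^{R}_{i,\lambda}=\mathscr T^{R}_{i+1,s_is_{i+1}\lambda}\circ\mathscr T^{R}_{i,s_{i+1}\lambda}\circ\mathscr T^{R}_{i+1,\lambda}.$$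
   Context: $\mathfrak t_n^*\simeq\mathbb R^n$ is the space of real characters of the diagonal torus of $\mathrm{GL}_n$, and $s_i=(i,i+1)\in S_n$ acts on $\lambda=(\lambda_1,\dots,\lambda_n)$ by exchanging $\lambda_i$ and $\lambda_{i+1}$. The operators $\mathscr T^{R}_{i,\lambda}$, $i\in\{1,\dots,n-1\}$, act on $\mathbb Z[\underline t^{\pm1},\underline x^{\pm1},y]=\mathbb Z[t_1^{\pm1},\dots,t_n^{\pm1},x_1^{\pm1},\dots,x_n^{\pm1},y]$ by $$\mathscr T^{R}_{i,\lambda}(f)=\frac{(1+y)\left(\frac{x_i}{x_{i+1}}\right)^{1-\lceil\lambda_{i+1}-\lambda_i\rceil}}{1-\frac{x_i}{x_{i+1}}}\,f+\frac{1+y\frac{x_i}{x_{i+1}}}{1-\frac{x_{i+1}}{x_i}}\,s_i^xf,$$ where $s_i^x$ exchanges $x_i$ and $x_{i+1}$ and fixes the $t$-variables and $y$. *)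

(* Defs.v *)
From HB Require Import structures.
From mathcomp Require Import all_boot all_order all_algebra perm.
From mathcomp Require Import mpoly ring.
From mathcomp Require Import boolp reals.

Set Implicit Arguments.
Unset Strict Implicit.
Unset Printing Implicit Defensive.

Import Order.TTheory GRing.Theory Num.Theory.
Local Open Scope ring_scope.

(* Meaningful for [phi] an injective ring morphism: the value then does not
   depend on the chosen fraction, see [frac_mapE]. *)
Definition frac_map (A B : idomainType) (phi : A -> B) (f : {fraction A}) :
    {fraction B} :=
  tofrac (phi \n_(repr f)) / tofrac (phi \d_(repr f)).

Lemma frac_numden (A : idomainType) (f : {fraction A}) :
  f = tofrac \n_(repr f) / tofrac \d_(repr f).
Proof.
have d0 : tofrac \d_(repr f) != 0 by rewrite tofrac_eq0 denom_ratioP.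
apply: (mulIf d0); rewrite mulfVK //.
rewrite -{1}[f]reprK; case: (repr f) => -[a b] /= b0.
rewrite !piE; apply/eqmodP; rewrite /= !FracField.equivfE.
rewrite !numden_Ratio ?mulr1 ?oner_neq0 //= mulrC.
by rewrite mulrC.
Qed.

Lemma frac_mapE (A B : idomainType) (phi : {rmorphism A -> B}) (p q : A) :
  injective phi -> q != 0 ->
  frac_map phi (tofrac p / tofrac q) = tofrac (phi p) / tofrac (phi q).
Proof.
move=> phi_inj q0; set f := tofrac p / tofrac q; rewrite /frac_map.
have phi0 (a : A) : a != 0 -> tofrac (phi a) != 0.
  by rewrite tofrac_eq0 -(rmorph0 phi) (inj_eq phi_inj).
have d0 := denom_ratioP (repr f).
have : tofrac p / tofrac q = tofrac \n_(repr f) / tofrac \d_(repr f).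
  by rewrite -frac_numden.
move/eqP; rewrite eqr_div ?tofrac_eq0 // -!tofracM tofrac_eq => /eqP e.
by apply/eqP; rewrite eqr_div ?phi0 // -!tofracM -!rmorphM e.
Qed.

(* Variables in the order t_0, ..., t_(n-1), x_0, ..., x_(n-1), y. *)
Notation txy n := {mpoly int[n + n + 1]}.

Notation txy_frac n := {fraction (txy n)}.

Definition t_idx (n : nat) (j : 'I_n) : 'I_(n + n + 1) := lshift 1 (lshift n j).
Definition x_idx (n : nat) (j : 'I_n) : 'I_(n + n + 1) := lshift 1 (rshift n j).
Definition y_idx (n : nat) : 'I_(n + n + 1) := rshift (n + n) ord0.

Definition tpol (n : nat) (j : 'I_n) : txy n := 'X_(t_idx j).
Definition xpol (n : nat) (j : 'I_n) : txy n := 'X_(x_idx j).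
Definition ypol (n : nat) : txy n := 'X_(y_idx n).

Definition xvar (n : nat) (j : 'I_n) : txy_frac n := tofrac (xpol j).
Definition yvar (n : nat) : txy_frac n := tofrac (ypol n).

Lemma mpolyX_neq0 (n : nat) (m : 'X_{1..n}) : 'X_[m] != 0 :> {mpoly int[n]}.
Proof. by rewrite -msize_poly_eq0 msizeX. Qed.

(* Z[t^(+-1), x^(+-1), y] inside Frac(Z[t, x, y]): every Laurent monomial
   denominator divides a power of the product of all t_j and x_j; y is not
   inverted. *)
Definition txprod (n : nat) : txy n := \prod_(j < n) (tpol j * xpol j).

Definition is_laurent (n : nat) : {pred txy_frac n} :=
  fun f => `[< exists (p : txy n) (k : nat),
                 f = tofrac p / tofrac (txprod n) ^+ k >].
Arguments is_laurent : clear implicits.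

Lemma txprod_neq0 (n : nat) : tofrac (txprod n) != 0 :> txy_frac n.
Proof.
rewrite tofrac_eq0; apply/prodf_neq0 => j _.
by rewrite mulf_neq0 // mpolyX_neq0.
Qed.

Lemma is_laurentP (n : nat) (f : txy_frac n) :
  reflect (exists (p : txy n) (k : nat), f = tofrac p / tofrac (txprod n) ^+ k)
          (f \in is_laurent n).
Proof. exact: asboolP. Qed.

Lemma tofrac_laurent (n : nat) (p : txy n) : tofrac p \in is_laurent n.
Proof. by apply/is_laurentP; exists p, 0; rewrite expr0 divr1. Qed.

Lemma subf_frac (F : fieldType) (p q d e : F) :
  d != 0 -> e != 0 -> p / d - q / e = (p * e - q * d) / (d * e).
Proof. by move=> d0 e0; rewrite -mulNr addf_div // mulNr. Qed.

Lemma swap_diff_frac (F : fieldType) (p a b q d : F) :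
  d != 0 -> b - a != 0 -> b != 0 ->
  (p / d - (p + (b - a) * q) / d) / (1 - a / b) = - (q * b) / d.
Proof. by move=> d0 ab0 b0; field; rewrite ab0 d0 b0. Qed.

Lemma TR_frac_rewrite (F : fieldType) (u v g y f : F) : u != 0 -> 1 - u != 0 ->
  (1 + y) * v / (1 - u) * f + (1 + y * u) / (1 - u^-1) * g
  = ((v - u) / (1 - u) + y * ((v - u ^+ 2) / (1 - u))) * f
    + (1 + y * u) * u * ((f - g) / (1 - u)).
Proof.
move=> u0 u1; have u2 : u - 1 != 0 by rewrite -oppr_eq0 opprB.
by field; rewrite u0 u1 u2.
Qed.

Lemma is_laurent_subring (n : nat) : subring_closed (is_laurent n).
Proof.
have D0 k : tofrac (txprod n) ^+ k != 0 :> txy_frac n.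
  by rewrite expf_neq0 // txprod_neq0.
split.
- by rewrite -[1](tofrac1 (txy n)) tofrac_laurent.
- move=> f g /is_laurentP[p [k ->]] /is_laurentP[q [l ->]].
  apply/is_laurentP; exists (p * txprod n ^+ l - q * txprod n ^+ k), (k + l)%N.
  rewrite tofracB !tofracM !tofracXn exprD; apply: subf_frac; exact: D0.
- move=> f g /is_laurentP[p [k ->]] /is_laurentP[q [l ->]].
  apply/is_laurentP; exists (p * q), (k + l)%N.
  by rewrite tofracM exprD mulf_div.
Qed.

HB.instance Definition _ (n : nat) :=
  GRing.isSubringClosed.Build (txy_frac n) (is_laurent n) (is_laurent_subring n).

Record laurent (n : nat) : Type :=
  Laurent { lval :> txy_frac n; lvalP : lval \in is_laurent n }.
HB.instance Definition _ (n : nat) := [isSub for @lval n].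
HB.instance Definition _ (n : nat) := [Choice of laurent n by <:].
HB.instance Definition _ (n : nat) :=
  [SubChoice_isSubComNzRing of laurent n by <:].

Definition ylau (n : nat) : laurent n := Laurent (tofrac_laurent (ypol n)).

(* The paper's 1 <= i <= n-1 is shifted by one: [i] with [i.+1 < n] stands for
   the adjacent pair of 0-based indices (i, i+1). *)
Definition adj0 (n i : nat) (hi : (i.+1 < n)%N) : 'I_n := Ordinal (ltnW hi).
Definition adj1 (n i : nat) (hi : (i.+1 < n)%N) : 'I_n := Ordinal hi.

Definition swap_x (n i : nat) (hi : (i.+1 < n)%N) : txy_frac n -> txy_frac n :=
  frac_map (msym (tperm (x_idx (adj0 hi)) (x_idx (adj1 hi)))).

Definition swap_wt (R : realType) (n i : nat) (hi : (i.+1 < n)%N)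
  (lam : 'rV[R]_n) : 'rV[R]_n := xcol (adj0 hi) (adj1 hi) lam.

Definition generic_wt (R : realType) (n : nat) (lam : 'rV[R]_n) : Prop :=
  forall j k : 'I_n, j != k -> lam 0 j - lam 0 k \isn't a Num.int.

(* The operator of the paper on the whole fraction field, where its formula
   makes sense; [TR] is its restriction to Laurent polynomials. *)
Definition TRfrac (R : realType) (n i : nat) (hi : (i.+1 < n)%N)
    (lam : 'rV[R]_n) (f : txy_frac n) : txy_frac n :=
  let xi := xvar (adj0 hi) in
  let xi1 := xvar (adj1 hi) in
  let y := yvar n in
  (1 + y) * (xi / xi1) ^ (1 - Num.ceil (lam 0 (adj1 hi) - lam 0 (adj0 hi)))
    / (1 - xi / xi1) * f
  + (1 + y * (xi / xi1)) / (1 - xi1 / xi) * swap_x hi f.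

Section Stability.
Variables (n i : nat) (hi : (i.+1 < n)%N).
Local Notation a := (adj0 hi).
Local Notation b := (adj1 hi).
Local Notation s := (tperm (x_idx a) (x_idx b)).
Local Notation u := (xvar a / xvar b).

Lemma msymU (m : nat) (w : 'S_m) (j : 'I_m) :
  msym w 'X_j = 'X_(w j) :> {mpoly int[m]}.
Proof. by rewrite /msym mmapX mmap1U. Qed.

Lemma x_idx_inj (j k : 'I_n) : x_idx j = x_idx k -> j = k.
Proof. by move/lshift_inj/rshift_inj. Qed.

Lemma adj_neq : a != b.
Proof. by rewrite -val_eqE /= neq_ltn ltnSn. Qed.

Lemma xvar_neq0 (j : 'I_n) : xvar j != 0.
Proof. by rewrite tofrac_eq0 mpolyX_neq0. Qed.

Lemma xvar_adj_neq : xvar a != xvar b.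
Proof.
rewrite tofrac_eq; apply/eqP => /(congr1 (mcoeff U_(x_idx a))).
rewrite !mcoeffX eqxx; case: eqP => // /(congr1 (fun m : 'X_{1..n + n + 1} => m (x_idx a))).
rewrite !mnm1E eqxx; case: eqP => // /x_idx_inj /eqP.
by rewrite eq_sym (negPf adj_neq).
Qed.

Lemma msym_sub_dvd (p : txy n) : exists q, msym s p - p = (xpol b - xpol a) * q.
Proof.
pose P (p : txy n) := exists q, msym s p - p = (xpol b - xpol a) * q.
have PD p1 p2 : P p1 -> P p2 -> P (p1 + p2).
  move=> [q1 e1] [q2 e2]; exists (q1 + q2).
  by rewrite mulrDr -e1 -e2 msymD; ring.
have PM p1 p2 : P p1 -> P p2 -> P (p1 * p2).
  move=> [q1 e1] [q2 e2]; exists (msym s p1 * q2 + q1 * p2).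
  have -> : (xpol b - xpol a) * (msym s p1 * q2 + q1 * p2)
    = msym s p1 * ((xpol b - xpol a) * q2) + ((xpol b - xpol a) * q1) * p2.
    by ring.
  by rewrite -e1 -e2 msymM; ring.
have PC c : P c%:MP.
  by exists 0; rewrite mulr0 /msym mmapC subrr.
have PX j : P 'X_j.
  rewrite /P msymU; case: tpermP => [->|->|_ _].
  - by exists 1; rewrite mulr1.
  - by exists (-1); rewrite mulrN1 opprB.
  - by exists 0; rewrite subrr mulr0.
rewrite -/(P p); elim/mpolyind: p => [|c m p _ _ Pp]; first exact: (PC 0).
apply: PD => //; rewrite -mul_mpolyC; apply: (PM) => //.
rewrite mpolyXE_id; apply: (big_ind P) => [||j _]; [exact: (PC 1)|exact: PM|].
elim: (m j) => [|k IH]; first by rewrite expr0; exact: (PC 1).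
by rewrite exprS; apply: PM.
Qed.

Lemma msym_txprod : msym s (txprod n) = txprod n.
Proof.
have st j : msym s (tpol j) = tpol j.
  by rewrite msymU tpermD // -val_eqE /= eqn_leq leqNgt ltn_addr ?ltn_ord.
have sx j : msym s (xpol j) = xpol (tperm a b j).
  by rewrite msymU -inj_tperm //; apply: x_idx_inj.
rewrite /txprod rmorph_prod /= big_split /=.
under eq_bigr do rewrite msymM st sx.
rewrite !big_split /=; congr (_ * _).
by rewrite [RHS](reindex_inj (@perm_inj _ (tperm a b))).
Qed.

Lemma swap_xE (p q : txy n) :
  q != 0 -> swap_x hi (tofrac p / tofrac q) = tofrac (msym s p) / tofrac (msym s q).
Proof. by apply: frac_mapE; apply: inj_msym. Qed.

Lemma div_xvar_laurent (j k : 'I_n) : xvar j / xvar k \in is_laurent n.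
Proof.
apply/is_laurentP.
exists (xpol j * tpol k * \prod_(l < n | l != k) (tpol l * xpol l)), 1.
have e : txprod n = xpol k * (tpol k * \prod_(l < n | l != k) (tpol l * xpol l)).
  by rewrite /txprod (bigD1 k) //=; ring.
apply/eqP; rewrite expr1 eqr_div ?xvar_neq0 ?txprod_neq0 //.
by rewrite -!tofracM e; apply/eqP; congr tofrac; ring.
Qed.

Lemma swap_diff_laurent (f : txy_frac n) :
  f \in is_laurent n -> (f - swap_x hi f) / (1 - u) \in is_laurent n.
Proof.
case/is_laurentP => p [k ->].
have D0 : txprod n ^+ k != 0 :> txy n.
  by rewrite -tofrac_eq0 tofracXn expf_neq0 // txprod_neq0.
have [q e] := msym_sub_dvd p.
apply/is_laurentP; exists (- (q * xpol b)), k.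
have sD : msym s (txprod n ^+ k) = txprod n ^+ k.
  by rewrite rmorphXn /=; congr (_ ^+ k); apply: msym_txprod.
rewrite -tofracXn swap_xE // sD.
have -> : msym s p = p + (xpol b - xpol a) * q by rewrite -e addrC subrK.
have dx : tofrac (xpol b) - tofrac (xpol a) != 0 :> txy_frac n.
  by rewrite subr_eq0 eq_sym xvar_adj_neq.
move: D0 dx (xvar_neq0 b); rewrite -tofrac_eq0 /xvar.
rewrite !(tofracD, tofracN, tofracM).
move: (tofrac _) (tofrac _) (tofrac _) (tofrac _) (tofrac _) => P A B Q D.
exact: swap_diff_frac.
Qed.

Lemma u_expz_laurent (z : int) : u ^ z \in is_laurent n.
Proof.
case: z => k; first exact/rpredX/div_xvar_laurent.
by rewrite NegzE -exprnN -exprVn invf_div rpredX ?div_xvar_laurent.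
Qed.

Lemma u_sub1_neq0 : 1 - u != 0.
Proof.
rewrite subr_eq0 eq_sym; apply: contra xvar_adj_neq => /eqP u1.
by apply/eqP/divr1_eq.
Qed.

Lemma u_expz_sub_laurent (z w : int) :
  (u ^ z - u ^ w) / (1 - u) \in is_laurent n.
Proof.
have pos (k : nat) : (u ^+ k - 1) / (1 - u) \in is_laurent n.
  rewrite subrX1 mulrAC -(opprB 1 u) mulNr divff ?u_sub1_neq0 // mulN1r.
  by rewrite rpredN rpred_sum // => l _; apply/rpredX/div_xvar_laurent.
have u0 : u != 0 by rewrite mulf_neq0 ?invr_eq0 ?xvar_neq0.
have pos2 (k : nat) (v : int) : (u ^ (v + k) - u ^ v) / (1 - u) \in is_laurent n.
  have -> : (u ^ (v + k) - u ^ v) / (1 - u) = u ^ v * ((u ^+ k - 1) / (1 - u)).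
    by rewrite expfzDr // -exprnP mulrA mulrBr mulr1.
  by rewrite rpredM ?u_expz_laurent ?pos.
wlog le_wz : z w / (w <= z)%R => [hw|].
  case: (lerP w z) => [/hw //|/ltW/hw].
  by rewrite -rpredN -mulNr opprB.
have -> : z = w + `|z - w|%N by rewrite gez0_abs ?subr_ge0 //; ring.
exact: pos2.
Qed.

Lemma TRfrac_laurent (R : realType) (lam : 'rV[R]_n) (f : txy_frac n) :
  f \in is_laurent n -> TRfrac hi lam f \in is_laurent n.
Proof.
move=> lf; rewrite /TRfrac; set z := 1 - _.
have u0 : u != 0 by rewrite mulf_neq0 ?invr_eq0 ?xvar_neq0.
have -> : xvar b / xvar a = u^-1 by rewrite invf_div.
have -> : (1 + yvar n) * u ^ z / (1 - u) * f
    + (1 + yvar n * u) / (1 - u^-1) * swap_x hi f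
  = ((u ^ z - u ^ 1%Z) / (1 - u) + yvar n * ((u ^ z - u ^ 2%Z) / (1 - u))) * f
    + (1 + yvar n * u) * u * ((f - swap_x hi f) / (1 - u)).
  rewrite -!exprnP expr1; move: (u ^ z) (swap_x hi f) (yvar n) u0 u_sub1_neq0.
  by move: (u) => U V G Y ? ?; apply: TR_frac_rewrite.
have ly : yvar n \in is_laurent n := tofrac_laurent _.
have lu : u \in is_laurent n := div_xvar_laurent _ _.
apply: rpredD; apply: rpredM.
- apply: rpredD; first exact: u_expz_sub_laurent.
  by apply: rpredM; rewrite ?u_expz_sub_laurent.
- exact: lf.
- by apply: rpredM => //; apply: rpredD; [exact: rpred1|exact: rpredM].
- exact: swap_diff_laurent.
Qed.

End Stability.

Definition TR (R : realType) (n i : nat) (hi : (i.+1 < n)%N) (lam : 'rV[R]_n)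
    (f : laurent n) : laurent n :=
  Laurent (TRfrac_laurent hi lam (lvalP f)).

(* Main.v *)
Require Import Defs.
From HB Require Import structures.
From mathcomp Require Import all_boot all_order all_algebra perm.
From mathcomp Require Import mpoly ring zify.
From mathcomp Require Import reals.

Set Implicit Arguments.
Unset Strict Implicit.
Unset Printing Implicit Defensive.

Import GRing.Theory Num.Theory.
Local Open Scope ring_scope.

(** Write u_i = x_i / x_(i+1) and let s_i be the exchange of x_i and x_(i+1),
    extended to an automorphism of the field of fractions. On that field the
    operator with weight lambda is
      f |-> a_k(u_i) f + b(u_i) s_i f,
      a_k(u) = (1 + y) u^(1-k) / (1 - u),   b(u) = (1 + y u) / (1 - u^-1),
    so lambda enters only through the integer
    k = ceil (lambda_(i+1) - lambda_i), and a Laurent polynomial is determined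
    by its image in the field. Both relations become identities between
    coefficients of products of the s_i.

    Quadratic relation. Replacing lambda by s_i lambda negates
    lambda_(i+1) - lambda_i; when this is not an integer, k becomes 1 - k. Then
    a_(1-k)(u^-1) = - a_k(u) cancels the coefficient of s_i f, and
    a_k(u) a_(1-k)(u) + b(u) b(u^-1) = - y is the coefficient of f
    ([demazure_lusztig_quadratic]).

    Braid relation. With p, q, r the ceilings of lambda_(i+1) - lambda_i,
    lambda_(i+2) - lambda_(i+1) and lambda_(i+2) - lambda_i, the two sides are
      T_i^q T_(i+1)^r T_i^p   and   T_(i+1)^p T_i^r T_(i+1)^q
    where the superscript is the integer k. Since r is the ceiling of a sum of
    two reals with ceilings p and q, it is p + q or p + q - 1, and the relation
    holds for either value. Put u = u_i and
    v = u_(i+1), so that s_i v = s_(i+1) u = u v. The coefficients of the three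
    longest products s_i s_(i+1) s_i, s_i s_(i+1), s_(i+1) s_i agree termwise;
    those of s_i and of s_(i+1) are two instances of a three-term relation
    between the a_k ([diag_coef_cocycle]); that of the identity is
    [diag_coef_triple]. *)

(** * Coefficients of the operators *)

Definition diag_coef (F : fieldType) (y : F) (k : int) (u : F) : F :=
  (1 + y) * u ^ (1 - k) / (1 - u).

Definition swap_coef (F : fieldType) (y u : F) : F :=
  (1 + y * u) / (1 - u^-1).

Definition demazure_lusztig (F : fieldType) (s : F -> F) (y u : F) (k : int)
    (f : F) : F :=
  diag_coef y k u * f + swap_coef y u * s f.

Section Coefficients.
Variables (F : fieldType) (y : F).

Lemma fmorph_diag_coef (s : {rmorphism F -> F}) (k : int) (u : F) :
  s y = y -> s (diag_coef y k u) = diag_coef y k (s u).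
Proof.
by move=> sy; rewrite fmorph_div rmorphM rmorphD rmorphB rmorph1 fmorphXz sy.
Qed.

Lemma fmorph_swap_coef (s : {rmorphism F -> F}) (u : F) :
  s y = y -> s (swap_coef y u) = swap_coef y (s u).
Proof.
by move=> sy; rewrite fmorph_div rmorphD rmorphM rmorphB rmorph1 fmorphV sy.
Qed.

Lemma diag_coefV (k : int) (u : F) :
  u != 0 -> 1 - u != 0 -> diag_coef y (1 - k) u^-1 = - diag_coef y k u.
Proof.
move=> u0 u1; rewrite /diag_coef subKr exprz_inv.
have -> : 1 - k = - k + 1 by rewrite addrC.
rewrite expfzDr // expr1z.
have u2 : u - 1 != 0 by rewrite -opprB oppr_eq0.
by field; rewrite u0 u1 u2.
Qed.

(** The second summand is the opposite of the right-hand side of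
    [diag_coefM_inv]: this is what makes the quadratic relation collapse to
    - y. In the braid relation the same splitting makes the term - y common to
    the two sides. *)
Lemma swap_coefM_inv (u : F) : u != 0 -> 1 - u != 0 ->
  swap_coef y u * swap_coef y u^-1 = - y - (1 + y) ^+ 2 * u / (1 - u) ^+ 2.
Proof.
move=> u0 u1; rewrite /swap_coef.
have u2 : u - 1 != 0 by rewrite -opprB oppr_eq0.
by field; rewrite u0 u1 u2 oner_neq0.
Qed.

Lemma diag_coefM_inv (k : int) (u : F) : u != 0 -> 1 - u != 0 ->
  diag_coef y k u * diag_coef y (1 - k) u = (1 + y) ^+ 2 * u / (1 - u) ^+ 2.
Proof.
move=> u0 u1; rewrite /diag_coef subKr.
have -> : 1 - k = - k + 1 by rewrite addrC.
rewrite expfzDr // expr1z -invr_expz.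
by field; rewrite u1 expfz_neq0.
Qed.

Section RankTwo.
Variables (u v : F) (p q r : int).
Hypotheses (u0 : u != 0) (v0 : v != 0).
Hypotheses (u1 : 1 - u != 0) (v1 : 1 - v != 0) (uv1 : 1 - u * v != 0).
Hypothesis rpq : r = p + q \/ r = p + q - 1.

(** Up to a common factor this is a partial fraction identity: for
    r = p + q - 1 it reads
      1 / ((1 - u)(1 - uv)) = 1 / ((1 - u)(1 - v)) - v / ((1 - v)(1 - uv)),
    and for r = p + q it reads
      u / ((1 - u)(1 - uv)) = 1 / ((1 - u)(1 - v)) - 1 / ((1 - v)(1 - uv)). *)
Lemma diag_coef_cocycle :
  diag_coef y q u * diag_coef y p (u * v) =
  diag_coef y p v * diag_coef y r u + diag_coef y r (u * v) * diag_coef y q v^-1.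
Proof.
have v2 : v - 1 != 0 by rewrite -opprB oppr_eq0.
rewrite /diag_coef !expfzMl exprz_inv -invr_expz.
have [er|er] : (1 - r = (1 - p) + (1 - q) - 1) \/ (1 - r = (1 - p) + (1 - q)).
  by case: rpq => ->; [left|right]; ring.
(* The exponents become opaque, so that only the four powers
   u^p', u^q', v^p', v^q' remain and the identity is rational in them. *)
all: move: (1 - p) (1 - q) (1 - r) er => p' q' r' ->.
all: rewrite !(expfzDr _ _ u0, expfzDr _ _ v0) -?invr_expz ?expr1z.
all: by field; rewrite ?expfz_neq0 ?u0 ?v0 ?u1 ?v1 ?v2 ?uv1.
Qed.

(** The coefficient of the identity in the braid relation. After
    [swap_coefM_inv] the terms in - y cancel, and what is left is
    proportional to the difference of u / (1 - u)^2 and v / (1 - v)^2. *)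
Lemma diag_coef_triple :
  diag_coef y q u * diag_coef y r v * diag_coef y p u
    + swap_coef y u * swap_coef y u^-1 * diag_coef y r (u * v) =
  diag_coef y p v * diag_coef y r u * diag_coef y q v
    + swap_coef y v * swap_coef y v^-1 * diag_coef y r (u * v).
Proof.
rewrite !swap_coefM_inv // /diag_coef !expfzMl.
have [er|er] : (1 - r = (1 - p) + (1 - q) - 1) \/ (1 - r = (1 - p) + (1 - q)).
  by case: rpq => ->; [left|right]; ring.
all: move: (1 - p) (1 - q) (1 - r) er => p' q' r' ->.
all: rewrite !(expfzDr _ _ u0, expfzDr _ _ v0) -?invr_expz ?expr1z.
all: by field; rewrite ?u0 ?v0 ?u1 ?v1 ?uv1.
Qed.
End RankTwo.
End Coefficients.

(** * The quadratic and braid relations over a field *)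

Section DemazureLusztig.
Variables (F : fieldType) (y : F).

(** Stated for this shape of sum because rewriting with [rmorphM] would also
    split the coefficients, which unfold to products. *)
Lemma fmorph_coef_comb (s : {rmorphism F -> F}) (k : int) (u g h : F) :
  s y = y ->
  s (diag_coef y k u * g + swap_coef y u * h) =
  diag_coef y k (s u) * s g + swap_coef y (s u) * s h.
Proof.
move=> sy; rewrite rmorphD (rmorphM s (diag_coef _ _ _)).
by rewrite (rmorphM s (swap_coef _ _)) fmorph_diag_coef ?fmorph_swap_coef.
Qed.

Lemma demazure_lusztig_quadratic (s : {rmorphism F -> F}) (u : F) (k : int)
    (f : F) :
  s y = y -> s u = u^-1 -> s (s f) = f -> u != 0 -> 1 - u != 0 ->
  demazure_lusztig s y u k (demazure_lusztig s y u (1 - k) f) = - y * f.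
Proof.
move=> sy su ssf u0 u1; rewrite /demazure_lusztig fmorph_coef_comb //.
rewrite su ssf diag_coefV //.
transitivity ((diag_coef y k u * diag_coef y (1 - k) u
  + swap_coef y u * swap_coef y u^-1) * f); first by ring.
by rewrite diag_coefM_inv // swap_coefM_inv // addrC subrK.
Qed.

(** Expanding both sides on the six products of s and t, the coefficients of
    s and t are compared by [diag_coef_cocycle], the second time with the roles
    of (u, q) and (v, p) exchanged, and that of the identity by
    [diag_coef_triple]. *)
Lemma demazure_lusztig_braid (s t : {rmorphism F -> F}) (u v : F)
    (p q r : int) (f : F) :
  s y = y -> t y = y ->
  s u = u^-1 -> s v = u * v -> t u = u * v -> t v = v^-1 ->
  s (s f) = f -> t (t f) = f -> s (t (s f)) = t (s (t f)) ->
  u != 0 -> v != 0 -> 1 - u != 0 -> 1 - v != 0 -> 1 - u * v != 0 ->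
  r = p + q \/ r = p + q - 1 ->
  demazure_lusztig s y u q
    (demazure_lusztig t y v r (demazure_lusztig s y u p f)) =
  demazure_lusztig t y v p
    (demazure_lusztig s y u r (demazure_lusztig t y v q f)).
Proof.
move=> sy ty su sv tu tv ssf ttf stsf u0 v0 u1 v1 uv1 rpq.
have suv : s (u * v) = v by rewrite rmorphM su sv mulKf.
have tuv : t (u * v) = u by rewrite rmorphM tu tv mulfK.
rewrite /demazure_lusztig !(fmorph_coef_comb _ _ _ _ sy, fmorph_coef_comb _ _ _ _ ty).
rewrite !(su, sv, tu, tv, suv, tuv, ssf, ttf, stsf).
have cs := diag_coef_cocycle y u0 v0 u1 v1 uv1 rpq.
have vu1 : 1 - v * u != 0 by rewrite mulrC.
have rqp : r = q + p \/ r = q + p - 1 by rewrite [q + p]addrC.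
have ct := diag_coef_cocycle y v0 u0 v1 u1 vu1 rqp.
have c1 := diag_coef_triple y u0 v0 u1 v1 uv1 rpq.
rewrite (mulrC v u) in ct.
transitivity ((diag_coef y q u * diag_coef y r v * diag_coef y p u
    + swap_coef y u * swap_coef y u^-1 * diag_coef y r (u * v)) * f
  + (diag_coef y q u * diag_coef y r v
      + diag_coef y r (u * v) * diag_coef y p u^-1) * (swap_coef y u * s f)
  + (diag_coef y q u * diag_coef y p (u * v)) * (swap_coef y v * t f)
  + swap_coef y v * swap_coef y (u * v) * diag_coef y q u * t (s f)
  + swap_coef y u * swap_coef y (u * v) * diag_coef y p v * s (t f)
  + swap_coef y u * swap_coef y v * swap_coef y (u * v) * t (s (t f))).
  by ring.
by rewrite c1 cs -ct; ring.
Qed.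
End DemazureLusztig.

(** * Automorphisms of the fraction field *)

Lemma frac_split (A : idomainType) (f : {fraction A}) :
  exists p q : A, q != 0 /\ f = tofrac p / tofrac q.
Proof.
by exists \n_(repr f), \d_(repr f); rewrite -frac_numden denom_ratioP.
Qed.

(** Relations between automorphisms of a fraction field, such as those between
    the s_i, may thus be checked on polynomials. *)
Lemma frac_rmorph_ext (A : idomainType) (F : fieldType)
    (phi psi : {rmorphism {fraction A} -> F}) :
  (forall a, phi (tofrac a) = psi (tofrac a)) -> phi =1 psi.
Proof.
move=> e f; have [p [q [_ ->]]] := frac_split f.
by rewrite !fmorph_div !e.
Qed.

Section FracMap.
Variables (A B : idomainType) (phi : {rmorphism A -> B}).
Hypothesis phi_inj : injective phi.

Lemma inj_rmorph_neq0 (a : A) : a != 0 -> phi a != 0.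
Proof. by rewrite -(rmorph0 phi) (inj_eq phi_inj). Qed.

Lemma frac_map_tofrac (p : A) : frac_map phi (tofrac p) = tofrac (phi p).
Proof.
by rewrite -[tofrac p]divr1 -tofrac1 frac_mapE ?oner_neq0 // rmorph1 tofrac1 divr1.
Qed.

Lemma frac_map_zmod_morphism : zmod_morphism (frac_map phi).
Proof.
move=> f g; have [p [q [q0 ->]]] := frac_split f.
have [p' [q' [q'0 ->]]] := frac_split g.
rewrite subf_frac ?tofrac_eq0 // -!tofracM -tofracB !frac_mapE ?mulf_neq0 //.
by rewrite subf_frac ?tofrac_eq0 ?inj_rmorph_neq0 // !(rmorphB, rmorphM).
Qed.

Lemma frac_map_monoid_morphism : monoid_morphism (frac_map phi).
Proof.
split; first by rewrite -tofrac1 frac_map_tofrac rmorph1.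
move=> f g; have [p [q [q0 ->]]] := frac_split f.
have [p' [q' [q'0 ->]]] := frac_split g.
rewrite mulf_div -!tofracM !frac_mapE ?mulf_neq0 // mulf_div.
by rewrite !rmorphM.
Qed.
End FracMap.

(** Both sides are the transposition of a and c, written as a conjugate. *)
Lemma tperm_braid (T : finType) (a b c : T) : a != b -> b != c -> a != c ->
  (tperm a b * tperm b c * tperm a b = tperm b c * tperm a b * tperm b c)%g.
Proof.
move=> ab bc ac.
have := tpermJ b c (tperm a b); rewrite fingroup.conjgE tpermV mulgA tpermR.
rewrite tpermD // => ->.
have := tpermJ a b (tperm b c); rewrite fingroup.conjgE tpermV mulgA tpermL.
by rewrite tpermD 1?eq_sym // => ->.
Qed.

Section Swap.
Variables (n i : nat) (hi : (i.+1 < n)%N).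

Lemma swap_x_zmod_morphism : zmod_morphism (swap_x hi).
Proof. exact/frac_map_zmod_morphism/inj_msym. Qed.

Lemma swap_x_monoid_morphism : monoid_morphism (swap_x hi).
Proof. exact/frac_map_monoid_morphism/inj_msym. Qed.

HB.instance Definition _ :=
  GRing.isZmodMorphism.Build (txy_frac n) (txy_frac n) (swap_x hi)
    swap_x_zmod_morphism.
HB.instance Definition _ :=
  GRing.isMonoidMorphism.Build (txy_frac n) (txy_frac n) (swap_x hi)
    swap_x_monoid_morphism.

Lemma swap_x_tofrac (p : txy n) :
  swap_x hi (tofrac p) =
  tofrac (msym (tperm (x_idx (adj0 hi)) (x_idx (Defs.adj1 hi))) p).
Proof. exact/frac_map_tofrac/inj_msym. Qed.

Lemma swap_x_div (f g : txy_frac n) :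
  swap_x hi (f / g) = swap_x hi f / swap_x hi g.
Proof. exact: fmorph_div. Qed.

Lemma swap_x_yvar : swap_x hi (yvar n) = yvar n.
Proof.
by rewrite swap_x_tofrac msymU tpermD // eq_lrshift.
Qed.

Lemma swap_x_xvar (j : 'I_n) :
  swap_x hi (xvar j) = xvar (tperm (adj0 hi) (Defs.adj1 hi) j).
Proof. by rewrite swap_x_tofrac msymU -inj_tperm //; apply: x_idx_inj. Qed.

Lemma swap_xK : involutive (swap_x hi).
Proof.
apply: (frac_rmorph_ext (phi := swap_x hi \o swap_x hi) (psi := idfun)) => p /=.
by rewrite !swap_x_tofrac -msymMm tperm2 msym1m.
Qed.
End Swap.

Lemma swap_x_braid (n i : nat) (hi : (i.+1 < n)%N) (hi1 : (i.+2 < n)%N)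
    (f : txy_frac n) :
  swap_x hi (swap_x hi1 (swap_x hi f)) =
  swap_x hi1 (swap_x hi (swap_x hi1 f)).
Proof.
have e : adj0 hi1 = Defs.adj1 hi by apply: val_inj.
have neq (j k : 'I_n) : val j != val k -> x_idx j != x_idx k.
  by apply: contraNneq => /x_idx_inj ->.
move: f; apply: (frac_rmorph_ext
  (phi := swap_x hi \o (swap_x hi1 \o swap_x hi))
  (psi := swap_x hi1 \o (swap_x hi \o swap_x hi1))) => p /=.
rewrite !swap_x_tofrac -!msymMm e !mulgA tperm_braid //; apply: neq => /=; lia.
Qed.

(** * The operators attached to a weight *)

Definition root_var (n i : nat) (hi : (i.+1 < n)%N) : txy_frac n :=
  xvar (adj0 hi) / xvar (Defs.adj1 hi).

Definition ceil_pairing (R : realType) (n i : nat) (hi : (i.+1 < n)%N)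
    (lam : 'rV[R]_n) : int :=
  Num.ceil (lam 0 (Defs.adj1 hi) - lam 0 (adj0 hi)).

Lemma TRfracE (R : realType) (n i : nat) (hi : (i.+1 < n)%N) (lam : 'rV[R]_n)
    (f : txy_frac n) :
  TRfrac hi lam f =
  demazure_lusztig (swap_x hi) (yvar n) (root_var hi) (ceil_pairing hi lam) f.
Proof.
by rewrite /demazure_lusztig /swap_coef /diag_coef /root_var invf_div.
Qed.

Lemma root_var_neq0 (n i : nat) (hi : (i.+1 < n)%N) : root_var hi != 0.
Proof. by rewrite mulf_neq0 ?invr_eq0 ?xvar_neq0. Qed.

Lemma swap_x_root_var (n i : nat) (hi : (i.+1 < n)%N) :
  swap_x hi (root_var hi) = (root_var hi)^-1.
Proof. by rewrite swap_x_div !swap_x_xvar tpermL tpermR invf_div. Qed.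

Lemma swap_wtE (R : realType) (n i : nat) (hi : (i.+1 < n)%N)
    (lam : 'rV[R]_n) (j : 'I_n) :
  swap_wt hi lam 0 j = lam 0 (tperm (adj0 hi) (Defs.adj1 hi) j).
Proof. by rewrite mxE. Qed.

Lemma ceil_opp_nonint (R : realType) (x : R) :
  x \isn't a Num.int -> Num.ceil (- x) = 1 - Num.ceil x.
Proof.
by move=> xN; rewrite ceilNfloor opprK ceil_floor xN /= opprD addrCA subrr addr0.
Qed.

Lemma ceilD_cases (R : realType) (x z : R) :
  Num.ceil (x + z) = Num.ceil x + Num.ceil z \/
  Num.ceil (x + z) = Num.ceil x + Num.ceil z - 1.
Proof.
have /andP[x1 x2] := ceil_itv x; have /andP[z1 z2] := ceil_itv z.
have le : Num.ceil (x + z) <= Num.ceil x + Num.ceil z.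
  by rewrite ceil_le_int rmorphD /= lerD.
have gt : Num.ceil x + Num.ceil z - 2 < Num.ceil (x + z).
  rewrite ceil_gt_int; have := ltrD x1 z1.
  by congr (_ < _); rewrite !(rmorphD, rmorphN) /=; ring.
lia.
Qed.

(** * Two adjacent simple reflections *)

Section Braid.
Variables (n i : nat) (hi : (i.+1 < n)%N) (hi1 : (i.+2 < n)%N).

Lemma adj0_next : adj0 hi1 = Defs.adj1 hi.
Proof. exact: val_inj. Qed.

Lemma root_var_mul : root_var hi * root_var hi1 = xvar (adj0 hi) / xvar (Defs.adj1 hi1).
Proof. by rewrite /root_var adj0_next mulrA divfK ?xvar_neq0. Qed.

Lemma adj_triple_neq :
  [/\ adj0 hi != Defs.adj1 hi, Defs.adj1 hi != Defs.adj1 hi1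
    & adj0 hi != Defs.adj1 hi1].
Proof. by rewrite -!val_eqE /=; split; lia. Qed.

Lemma swap_next_root_var :
  swap_x hi1 (root_var hi) = root_var hi * root_var hi1.
Proof.
have [e01 e12 e02] := adj_triple_neq.
rewrite root_var_mul swap_x_div !swap_x_xvar adj0_next tpermL.
by rewrite tpermD // eq_sym.
Qed.

Lemma swap_prev_root_var :
  swap_x hi (root_var hi1) = root_var hi * root_var hi1.
Proof.
have [e01 e12 e02] := adj_triple_neq.
by rewrite root_var_mul swap_x_div !swap_x_xvar adj0_next tpermR tpermD.
Qed.

(** The image of 1 - u_i under s_(i+1). *)
Lemma root_var_mul_neq1 : 1 - root_var hi * root_var hi1 != 0.
Proof.
rewrite -swap_next_root_var -(rmorph1 (swap_x hi1)) -(rmorphB (swap_x hi1)).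
by rewrite fmorph_eq0 u_sub1_neq0.
Qed.
Section Pairings.
Variables (R : realType) (lam : 'rV[R]_n).

(** The next three lemmas match the integers of the two sides of the braid
    relation: along s_i s_(i+1) s_i the pairings occur in the order p, r, q,
    along s_(i+1) s_i s_(i+1) in the order q, r, p. *)
Lemma ceil_pairing_end :
  ceil_pairing hi (swap_wt hi1 (swap_wt hi lam)) = ceil_pairing hi1 lam.
Proof.
have [e01 e12 e02] := adj_triple_neq.
rewrite /ceil_pairing !swap_wtE adj0_next tpermL.
rewrite (@tpermD _ _ _ (adj0 hi)) 1?eq_sym // tpermL.
by rewrite (@tpermD _ _ _ (Defs.adj1 hi1)).
Qed.

Lemma ceil_pairing_start :
  ceil_pairing hi1 (swap_wt hi (swap_wt hi1 lam)) = ceil_pairing hi lam.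
Proof.
have [e01 e12 e02] := adj_triple_neq.
rewrite /ceil_pairing !swap_wtE adj0_next tpermR.
rewrite (@tpermD _ _ _ (Defs.adj1 hi1)) // tpermR.
by rewrite (@tpermD _ _ _ (adj0 hi)) 1?eq_sym.
Qed.

Lemma ceil_pairing_middle :
  ceil_pairing hi1 (swap_wt hi lam) = ceil_pairing hi (swap_wt hi1 lam).
Proof.
have [e01 e12 e02] := adj_triple_neq.
rewrite /ceil_pairing !swap_wtE adj0_next tpermR tpermL.
by rewrite !tpermD // eq_sym.
Qed.

Lemma ceil_pairing_sum :
  ceil_pairing hi (swap_wt hi1 lam) = ceil_pairing hi lam + ceil_pairing hi1 lam
  \/ ceil_pairing hi (swap_wt hi1 lam) =
     ceil_pairing hi lam + ceil_pairing hi1 lam - 1.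
Proof.
have [e01 e12 e02] := adj_triple_neq.
have := ceilD_cases (lam 0 (Defs.adj1 hi) - lam 0 (adj0 hi))
  (lam 0 (Defs.adj1 hi1) - lam 0 (adj0 hi1)).
rewrite /ceil_pairing !swap_wtE adj0_next tpermL tpermD 1?eq_sym //.
have -> : lam 0 (Defs.adj1 hi) - lam 0 (adj0 hi)
    + (lam 0 (Defs.adj1 hi1) - lam 0 (Defs.adj1 hi))
  = lam 0 (Defs.adj1 hi1) - lam 0 (adj0 hi) by rewrite addrC addrA subrK.
by [].
Qed.
End Pairings.
End Braid.

Theorem proposition11p7 (R : realType) (n : nat) (lam : 'rV[R]_n) :
  (generic_wt lam ->
   forall (i : nat) (hi : (i.+1 < n)%N),
     TR hi lam \o TR hi (swap_wt hi lam) =1 (fun f => - ylau n * f)) /\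
  (forall (i : nat) (hi : (i.+1 < n)%N) (hi1 : (i.+2 < n)%N),
     TR hi (swap_wt hi1 (swap_wt hi lam)) \o TR hi1 (swap_wt hi lam)
       \o TR hi lam
     =1 TR hi1 (swap_wt hi (swap_wt hi1 lam)) \o TR hi (swap_wt hi1 lam)
       \o TR hi1 lam).
Proof.
split=> [gen i hi f | i hi hi1 f]; apply: val_inj; rewrite /= !TRfracE.
  have -> : ceil_pairing hi (swap_wt hi lam) = 1 - ceil_pairing hi lam.
    rewrite /ceil_pairing !swap_wtE tpermL tpermR -ceil_opp_nonint ?opprB //.
    by apply: gen; rewrite eq_sym adj_neq.
  apply: (demazure_lusztig_quadratic (s := swap_x hi)).
  - exact: swap_x_yvar.
  - exact: swap_x_root_var.
  - exact: swap_xK.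
  - exact: root_var_neq0.
  - exact: u_sub1_neq0.
rewrite ceil_pairing_end ceil_pairing_start ceil_pairing_middle.
apply: (demazure_lusztig_braid (s := swap_x hi) (t := swap_x hi1)).
- exact: swap_x_yvar.
- exact: swap_x_yvar.
- exact: swap_x_root_var.
- exact: swap_prev_root_var.
- exact: swap_next_root_var.
- exact: swap_x_root_var.
- exact: swap_xK.
- exact: swap_xK.
- exact: swap_x_braid.
- exact: root_var_neq0.
- exact: root_var_neq0.
- exact: u_sub1_neq0.
- exact: u_sub1_neq0.
- exact: root_var_mul_neq1.
exact: ceil_pairing_sum.
Qed.
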